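(* Let $0<p<q<\infty$ and $\nu\in\widehat{\mathcal D}$. Then $T_\omega:A^p_\nu\to L^q_\nu$ is unbounded (i.e. not bounded) for each radial weight $\omega$.
   Context: $\mathbb D$ is the open unit disc and $dA(z)=\frac{dx\,dy}{\pi}$. A weight is a function $\omega:\mathbb D\to[0,\infty)$ integrable over $\mathbb D$; it is radial if $\omega(z)=\omega(|z|)$ for all $z$. For a radial weight, $\widehat\omega(z)=\int_{|z|}^1\omega(s)\,ds$, and it is assumed throughout that $\widehat\omega(z)>0$ for all $z\in\mathbb D$ and $\widehat\omega(0)<\infty$. A radial weight $\nu$ belongs to $\widehat{\mathcal D}$ if there is $C>1$ with $\widehat\nu(r)\le C\,\widehat\nu\left(\frac{1+r}{2}\right)$ for all $0\le r<1$. $L^q_\nu$ is the space of complex-valued measurable $f$ on $\mathbb D$ with $\|f\|_{L^q_\nu}^q=\int_{\mathbb D}|f|^q\nu\,dA<\infty$, and $A^p_\nu$ is the space of analytic functions in $L^p_\nu$. The radial averaging operator is $$T_\omega(f)(z)=\frac{1}{\widehat\omega(z)}\int_{|z|}^1 f\left(s\tfrac{z}{|z|}\right)\omega(s)\,ds,\quad z\in\mathbb D\setminus\{0\}.$$ $T_\omega:A^p_\nu\to L^q_\nu$ is bounded if $T_\omega f$ is well defined almost everywhere and $\|T_\omega f\|_{L^q_\nu}\le C\|f\|_{A^p_\nu}$ for all $f\in A^p_\nu$, with $C$ independent of $f$. *)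

(* Defs.v *)
From HB Require Import structures.
From mathcomp Require Import all_boot all_order all_algebra.
From mathcomp Require Import all_classical all_reals all_analysis.
From mathcomp Require Import complex.

Set Implicit Arguments.
Unset Strict Implicit.
Unset Printing Implicit Defensive.

Import Order.TTheory GRing.Theory Num.Theory.
Import numFieldNormedType.Exports.

Local Open Scope classical_set_scope.
Local Open Scope ring_scope.
Local Open Scope complex_scope.

(* The library's measurable functions on R and on R * R are the Borel ones,
   whereas measurability in L^p theory is Lebesgue measurability, that is,
   almost everywhere equality with a Borel function. For Lebesgue measurable
   functions \int is still the Lebesgue integral: for f >= 0 it is the supremum
   of the integrals of the Borel simple functions below f, and changing f on a
   null set does not affect it. *)
Definition lebesgue_measurable_fun (d : measure_display)
    (T : measurableType d) (R : realType) (mu : {measure set T -> \bar R})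
    (D : set T) (f : T -> R) : Prop :=
  exists2 g : T -> R, measurable_fun D g &
    {ae mu, forall x, D x -> f x = g x}.

Definition lebesgue_integrable (d : measure_display)
    (T : measurableType d) (R : realType) (mu : {measure set T -> \bar R})
    (D : set T) (f : T -> R) : Prop :=
  lebesgue_measurable_fun mu D f /\
  (\int[mu]_(x in D) `|f x|%:E < +oo)%E.

Section radial_averaging.
Variable R : realType.
Implicit Types (f : R[i] -> R[i]) (w nu omega : R[i] -> R) (z : R[i]).

Local Notation leb := (@lebesgue_measure R).

(* The modulus as a real number: `|z| has type R[i]. *)
Definition modc z : R := ComplexField.Normc.normc z.

(* Functions on the disc are encoded as total functions on R[i]; nothing below
   depends on their values outside of the disc. *)
Definition disc : set R[i] := [set z | modc z < 1].

(* Integration takes place on R * R, which carries the product measure. *)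
Definition toC (u : measurableTypeR R * measurableTypeR R) : R[i] :=
  u.1 +i* u.2.

Definition discP : set (measurableTypeR R * measurableTypeR R) :=
  toC @^-1` disc.

(* dx dy / pi *)
Definition dA : {measure set (measurableTypeR R * measurableTypeR R)
                   -> \bar R} :=
  mscale ((NngNum (pi_ge0 R))%:num^-1)%:nng (leb \x leb)%E.

Definition weight w : Prop :=
  (forall z, disc z -> 0 <= w z) /\ lebesgue_integrable dA discP (w \o toC).

Definition radial w : Prop := forall z, disc z -> w z = w (modc z)%:C.

Definition hat w z : \bar R :=
  (\int[leb]_(s in `[modc z, 1%R[) (w s%:C)%:E)%E.

(* Radial weights, subject to the standing assumptions. Measurability of
   s |-> w s on [0, 1[ follows from that of w on the disc by radiality; it is
   recorded next to the finiteness of hat w 0, the two of them saying that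
   w is integrable on [0, 1[. *)
Definition radial_weight w : Prop :=
  [/\ weight w,
      radial w,
      lebesgue_measurable_fun leb `[0, 1[ (fun s : R => w s%:C),
      (forall z, disc z -> (0 < hat w z)%E)
    & (hat w 0%R < +oo)%E].

Definition Dhat nu : Prop :=
  radial_weight nu /\
  exists2 C : R, 1 < C & forall r : R, 0 <= r -> r < 1 ->
    (hat nu r%:C <= C%:E * hat nu ((1 + r) / 2)%R%:C)%E.

Definition Lnormw (q : R) nu f : \bar R :=
  poweR (\int[dA]_(u in discP) (modc (f (toC u)) `^ q * nu (toC u))%R%:E)%E
        q^-1.

Definition in_Lw (q : R) nu f : Prop :=
  [/\ lebesgue_measurable_fun dA discP (fun u => complex.Re (f (toC u))),
      lebesgue_measurable_fun dA discP (fun u => complex.Im (f (toC u)))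
    & (\int[dA]_(u in discP) (modc (f (toC u)) `^ q * nu (toC u))%R%:E
       < +oo)%E].

(* The scalar field of the normed module R[i]^o is R[i] itself, so that this is
   complex differentiability. *)
Definition analytic_on_disc f : Prop :=
  forall z, disc z -> derivable (f : R[i]^o -> R[i]^o) (z : R[i]^o) 1.

Definition in_Aw (p : R) nu f : Prop := analytic_on_disc f /\ in_Lw p nu f.

Definition radial_integrand omega f z (s : R) : R[i] :=
  f (s%:C * (z / (modc z)%:C)) * (omega s%:C)%:C.

Definition T_well_defined omega f z : Prop :=
  lebesgue_integrable leb `[modc z, 1[
    (fun s : R => complex.Re (radial_integrand omega f z s)) /\
  lebesgue_integrable leb `[modc z, 1[
    (fun s : R => complex.Im (radial_integrand omega f z s)).

Definition T_avg omega f z : R[i] :=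
  ((\int[leb]_(s in `[modc z, 1[) complex.Re (radial_integrand omega f z s))
   +i*
   (\int[leb]_(s in `[modc z, 1[) complex.Im (radial_integrand omega f z s)))
  / (fine (hat omega z))%:C.

Definition T_bounded omega nu (p q : R) : Prop :=
  exists C : R, forall f, in_Aw p nu f ->
    [/\ {ae dA, forall u, discP u -> toC u != 0 ->
                  T_well_defined omega f (toC u)},
        in_Lw q nu (T_avg omega f)
      & (Lnormw q nu (T_avg omega f) <= C%:E * Lnormw p nu f)%E].

End radial_averaging.

(* Main.v *)
Require Import Defs.
From mathcomp Require Import all_boot all_order all_algebra.
From mathcomp Require Import all_classical all_reals all_analysis.
From mathcomp Require Import measurable_realfun complex ring lra.

(** With d = 2^-N and a = 1 - d, test the boundedness on f(z) = (1 - a z)^-n,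
    n large. The doubling property of nu gives
      int |f|^p nu dA <= K d^-np u_N,   u_N := d nuhat(a),
    by induction on N: the kernel max(d, |1 - z|)^-np grows with N only on the
    sector of aperture ~ d at 1, which has nu dA mass ~ u_N. On the sector of
    radii [a, 1[ and aperture d / 2n one has Re f >= c d^-n along every ray, so
    T_omega f, being an average along rays, is at least c d^-n there whatever
    omega is, and int |T_omega f|^q nu dA >= c' d^-nq u_N. Boundedness would
    give u_N^(1/q) <= L u_N^(1/p) for all N, which contradicts u_N --> 0. *)

Set Implicit Arguments.
Unset Strict Implicit.
Unset Printing Implicit Defensive.

Import Order.TTheory GRing.Theory Num.Theory.
Import numFieldNormedType.Exports.

Local Open Scope classical_set_scope.
Local Open Scope ring_scope.

(** Why n must be large: by doubling, u_N may shrink by a factor 2C at each step, so d^-np has to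
    grow by at least 4C; then each step inherits at most half of the claimed bound, and the new
    sector fills the rest. Why Re f and the small aperture: an average along a ray could lose size
    by cancellation, and an aperture d / 2n keeps the argument of 1 - a z so small that its n-th
    power still has a dominant real part. Both norms then carry the same factor d^-n, which cancels
    and leaves only the powers of u_N. The obstacle is measurability: nu and omega are Borel only up
    to null sets, and T_omega f is estimated with no measurability known. Integrals are therefore
    compared by monotonicity of the integral of nonnegative functions, which holds for all
    integrands, and equalities go through Borel representatives. *)

(** * Integrals of nonnegative functions that need not be Borel *)

Section nonmeasurable_integrands.
Local Open Scope ereal_scope.
Context d (T : measurableType d) (R : realType).
Variables (mu : {measure set T -> \bar R}) (D : set T).
Implicit Types f g : T -> \bar R.

(** The integral is a supremum over simple functions below the integrand, and a simple function
    below f is also below g. *)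
Lemma ge0_le_integral_nonmeas f g : (forall x, D x -> 0 <= f x) ->
  (forall x, D x -> f x <= g x) ->
  \int[mu]_(x in D) f x <= \int[mu]_(x in D) g x.
Proof.
move=> f0 fg; rewrite !ge0_integralE//; last first.
  by move=> x Dx; rewrite (le_trans (f0 _ Dx)) ?fg.
apply: ge_ereal_sup => _ [h hf <-].
apply: ereal_sup_ubound; exists h => // x.
by rewrite (le_trans (hf x))// lee_restrict.
Qed.

(** On the exceptional null set N nothing is known of f, so it is squeezed between [lo] and [up],
    which are g off N and 0, respectively +oo, on N. Both are measurable and have the integral of
    g. *)
Lemma ge0_ae_eq_integral_nonmeas f g : measurable D -> measurable_fun D g ->
  (forall x, D x -> 0 <= f x) -> (forall x, D x -> 0 <= g x) ->
  {ae mu, forall x, D x -> f x = g x} ->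
  \int[mu]_(x in D) f x = \int[mu]_(x in D) g x.
Proof.
move=> mD mg f0 g0 [N [mN N0 fgN]].
have fg x : ~ N x -> D x -> f x = g x.
  by move=> Nx; apply: contrapT => fgx; apply: Nx; exact: fgN.
have mDN : measurable (D `\` N) by exact: measurableD.
have mDI : measurable (D `&` N) by exact: measurableI.
pose lo := (fun x => if x \in N then 0 else g x).
pose up := (fun x => if x \in N then +oo else g x).
have mN' : measurable_fun D (fun x => x \in N).
  apply: (measurable_fun_bool true) => //.
  rewrite (_ : _ @^-1` _ = N) ; first exact: measurableI.
  by apply/seteqP; split => x /= => [/set_mem|/mem_set].
have mlo : measurable_fun D lo.
  by apply: measurable_fun_if => //; exact: measurable_funS mg.
have mup : measurable_fun D up.
  by apply: measurable_fun_if => //; exact: measurable_funS mg.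
have aelo : \int[mu]_(x in D) lo x = \int[mu]_(x in D) g x.
  apply: ge0_ae_eq_integral => //.
    by move=> x Dx; rewrite /lo; case: ifPn => // _; exact: g0.
  exists N; split => // x /=; apply: contra_notP => Nx _.
  by rewrite /lo memNset.
have aeup : \int[mu]_(x in D) up x = \int[mu]_(x in D) g x.
  apply: ge0_ae_eq_integral => //.
    by move=> x Dx; rewrite /up; case: ifPn => // _; exact: g0.
  exists N; split => // x /=; apply: contra_notP => Nx _.
  by rewrite /up memNset.
apply/eqP; rewrite eq_le -{1}aeup -{1}aelo; apply/andP; split.
  apply: ge0_le_integral_nonmeas => // x Dx; rewrite /up.
  by case: ifPn => [_|]; [rewrite leey|rewrite notin_setE => Nx; rewrite fg].
apply: ge0_le_integral_nonmeas => x Dx; rewrite /lo; case: ifPn => // Nx.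
- exact: g0.
- exact: f0.
- by move: Nx; rewrite notin_setE => Nx; rewrite fg.
Qed.

Lemma ge0_borel_representative (f : T -> R) : measurable D ->
  lebesgue_measurable_fun mu D f -> (forall x, D x -> 0 <= f x)%R ->
  exists g : T -> R, [/\ measurable_fun setT g, (forall x, 0 <= g x)%R &
    {ae mu, forall x, D x -> f x = g x}].
Proof.
move=> mD [g mg fg] f0.
exists ((fun x => Num.max (g x) 0%R) \_ D); split.
- apply/(measurable_restrictT _ mD).1.
  by apply: measurable_maxr => //; exact: measurable_cst.
- by move=> x; rewrite patchE; case: ifPn => // _; rewrite le_max lexx orbT.
- apply: filterS fg => x /= fg Dx; rewrite patchE (mem_set Dx) -fg//.
  by apply/esym/max_idPl; exact: f0.
Qed.

End nonmeasurable_integrands.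

(** * Change of variable x -> c x on the line *)

Section dilation.
Context {R : realType}.
Local Notation leb := (@lebesgue_measure R).

Lemma ge0_integral_dilation (c : R) (f : R -> \bar R) : 0 < c ->
  measurable_fun setT f -> (forall x, 0 <= f x)%E ->
  (\int[leb]_x f x = c%:E * \int[leb]_x f (c * x)%R)%E.
Proof.
move=> c0 mf f0.
pose phi := ( *%R c : R -> measurableTypeR R).
have mphi : measurable_fun [set: measurableTypeR R] phi
  by exact: mulrl_measurable.
have c0' : 0 <= c by exact: ltW.
pose mu_ : {measure set _ -> \bar R} :=
  mscale (NngNum c0') (pushforward leb phi).
pose mu := mu_ mphi.
(* Lebesgue measure is determined by the intervals ]a, b], whose preimages ]a/c, b/c] are shorter by
   the factor c. *)
have lebE A : measurable A -> leb A = mu A.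
  move=> mA; apply: lebesgue_measure_unique => // _ [[a b] /= _ <-].
  rewrite /mu /mscale /= /pushforward.
  have -> : phi @^-1` [set` `]a, b]] = [set` `](a / c), (b / c)]].
    apply/seteqP; split => x; rewrite /= !in_itv/= ltr_pdivrMr// ler_pdivlMr//.
      by rewrite !(mulrC x).
    by rewrite !(mulrC x).
  rewrite !lebesgue_measure_itv/= !lte_fin ltr_pM2r ?invr_gt0//.
  case: ifPn => _; last by rewrite mule0.
  by rewrite -EFinB -EFinM; congr EFin; field; rewrite gt_eqF.
rewrite (eq_measure_integral mu); last by move=> A mA _; exact: lebE.
rewrite ge0_integral_mscale//= ge0_integral_pushforward//.
Qed.

End dilation.

Section measurability.
Context {R : realType}.

(** Inversion is discontinuous at 0, so it is written as x (x^2)^-1 with a measurable real power; at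
    0 both sides are 0. *)
Lemma measurable_invr : measurable_fun [set: R] (@GRing.inv R).
Proof.
rewrite (_ : GRing.inv = fun x : R => x * (x ^+ 2) `^ (-1)).
  apply: measurable_funM => //.
  exact: (measurableT_comp (@measurable_powR R (-1)) (exprn_measurable _)).
apply/funext => x; rewrite powR_inv1 ?sqr_ge0//.
have [->|x0] := eqVneq x 0; first by rewrite mul0r invr0.
by rewrite expr2 invfM mulrA divff// mul1r.
Qed.

Lemma measurable_sqrtr : measurable_fun [set: R] (@Num.sqrt R).
Proof. by apply: continuous_measurable_fun; exact: sqrt_continuous. Qed.

End measurability.

(** * Polar coordinates on the right half-plane *)

Section sector_polar_coordinates.
Context {R : realType}.
Local Notation leb := (@lebesgue_measure R).

(** As a factor of the integrand it replaces the restriction to x > 0, so that Tonelli and dilations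
    apply on the whole space; it is invariant under dilations by positive factors. *)
Definition heaviside (x : R) : R := (0 < x)%R%:R.
Local Notation pos := heaviside.
Arguments heaviside : simpl never.

Lemma heaviside_gt0 (x : R) : 0 < x -> pos x = 1.
Proof. by rewrite /heaviside => ->. Qed.

Lemma heaviside_le0 (x : R) : x <= 0 -> pos x = 0.
Proof. by rewrite /heaviside ltNge => ->. Qed.

Lemma heaviside_ge0 (x : R) : 0 <= pos x.
Proof. exact: ler0n. Qed.

Lemma measurable_heaviside : measurable_fun setT pos.
Proof.
rewrite (_ : pos = \1_(`]0, +oo[%classic)); first exact: measurable_indic.
by apply/funext => x; rewrite indicE mem_setE in_itv/= andbT.
Qed.

(* The slope t = y / x replaces the angle: (x, t) |-> (x, t x) is a dilation in
   y for fixed x, and for fixed t the modulus is the dilation x sqrt(1 + t^2)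
   of x, so that Tonelli and dilations suffice. *)
Lemma ge0_integral_sector_polar (h k : R -> R) :
  measurable_fun setT h -> measurable_fun setT k ->
  (forall x, 0 <= h x) -> (forall x, 0 <= k x) ->
  (\int[leb \x leb]_(u in [set u | (0 < u.1)%R])
     (h (Num.sqrt (u.1 ^+ 2 + u.2 ^+ 2)) * k (u.2 / u.1))%R%:E =
   (\int[leb]_t (k t / (1 + t ^+ 2))%R%:E) *
   \int[leb]_(s in `]0%R, +oo[) (h s * s)%R%:E)%E.
Proof.
move=> mh mk h0 k0.
have mpos := measurable_heaviside.
pose rad t : R := Num.sqrt (1 + t ^+ 2).
have rad2 t : rad t ^+ 2 = 1 + t ^+ 2 by rewrite sqr_sqrtr// addr_ge0 ?sqr_ge0.
have rad_gt0 t : 0 < rad t by rewrite sqrtr_gt0 ltr_wpDr// sqr_ge0.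
have mrad : measurable_fun setT rad.
  apply: (measurableT_comp measurable_sqrtr).
  by apply: measurable_funD => //; exact: measurable_funX.
pose F (u : measurableTypeR R * measurableTypeR R) : \bar R :=
  (pos u.1 * (h (Num.sqrt (u.1 ^+ 2 + u.2 ^+ 2)) * k (u.2 / u.1)))%:E.
have F0 u : (0 <= F u)%E by rewrite lee_fin !mulr_ge0.
have mF : measurable_fun setT F.
  apply/measurable_EFinP; apply: measurable_funM.
    exact: measurableT_comp.
  apply: measurable_funM.
    apply: (measurableT_comp mh); apply: (measurableT_comp measurable_sqrtr).
    by apply: measurable_funD; exact: measurable_funX.
  apply: (measurableT_comp mk); apply: measurable_funM => //.
  exact: (measurableT_comp measurable_invr).
pose G (u : measurableTypeR R * measurableTypeR R) : \bar R :=
  (pos u.1 * u.1 * (h (u.1 * rad u.2) * k u.2))%:E.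
have G0 u : (0 <= G u)%E.
  rewrite lee_fin; apply: mulr_ge0; last by rewrite mulr_ge0.
  have [u0|/ltW u0] := leP u.1 0; first by rewrite heaviside_le0 ?mul0r.
  by rewrite mulr_ge0// heaviside_ge0.
have mG : measurable_fun setT G.
  apply/measurable_EFinP; apply: measurable_funM.
    by apply: measurable_funM => //; exact: measurableT_comp.
  apply: measurable_funM.
    apply: (measurableT_comp mh); apply: measurable_funM => //.
    exact: measurableT_comp.
  exact: measurableT_comp.
have sh x : (0 <= (pos x * x * h x)%:E)%E.
  rewrite lee_fin; apply: mulr_ge0 => //.
  have [u0|/ltW u0] := leP x 0; first by rewrite heaviside_le0 ?mul0r.
  by rewrite mulr_ge0// heaviside_ge0.
have mH : measurable_fun setT (fun x => (pos x * x * h x)%:E).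
  apply/measurable_EFinP; apply: measurable_funM => //.
  exact: measurable_funM.
transitivity (\int[leb \x leb]_u F u)%E.
  rewrite integral_mkcond; apply: eq_integral => u _.
  rewrite patchE /F; case: ifPn => [/set_mem/= u0|].
    by rewrite heaviside_gt0// mul1r.
  by rewrite notin_setE/= => /negP; rewrite -leNgt => u0; rewrite heaviside_le0 ?mul0r.
rewrite fubini_tonelli1//.
transitivity (\int[leb]_x \int[leb]_t G (x, t))%E.
  apply: eq_integral => x _; rewrite /fubini_F.
  have [x0|x0] := leP x 0.
    by rewrite !integral0_eq// => y _; rewrite /F /G/= heaviside_le0 ?mul0r.
  (* For fixed x > 0, substitute y = x t; the Jacobian is x. *)
  rewrite [LHS](ge0_integral_dilation x0)//; last exact: measurableT_comp.
  rewrite -ge0_integralZl_EFin//; last 2 first.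
    - apply: measurableT_comp => //; apply: measurableT_comp => //.
    - exact: ltW.
  apply: eq_integral => t _; rewrite /F /G /= heaviside_gt0// -EFinM; congr EFin.
  have -> : x ^+ 2 + (x * t) ^+ 2 = x ^+ 2 * (1 + t ^+ 2) by ring.
  rewrite sqrtrM ?sqr_ge0// sqrtr_sqr gtr0_norm//.
  by rewrite (mulrC x t) mulfK ?gt_eqF// !mul1r.
rewrite fubini_tonelli//.
rewrite [X in (_ * X)%E]integral_mkcond.
have -> : (\int[leb]_x ((fun s => (h s * s)%:E) \_ `]0%R, +oo[) x =
    \int[leb]_x (pos x * x * h x)%:E)%E.
  apply: eq_integral => x _; rewrite patchE; case: ifPn => [/set_mem/=|].
    by rewrite in_itv/= andbT => x0; rewrite heaviside_gt0// mul1r mulrC.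
  rewrite notin_setE/= in_itv/= andbT => /negP; rewrite -leNgt => x0.
  by rewrite heaviside_le0 ?mul0r.
rewrite -ge0_integralZr//; last 3 first.
- apply/measurable_EFinP; apply: measurable_funM => //.
  apply: (measurableT_comp measurable_invr).
  by apply: measurable_funD => //; exact: measurable_funX.
- by move=> t _; rewrite lee_fin divr_ge0// addr_ge0 ?sqr_ge0.
- by apply: integral_ge0 => x _; exact: sh.
apply: eq_integral => t _.
(* With s = x sqrt(1 + t^2), s ds becomes (1 + t^2) x dx, which cancels the denominator. *)
rewrite [X in (_ * X)%E](ge0_integral_dilation (rad_gt0 t))//.
have mH' : measurable_fun setT
    (fun x => (pos (rad t * x) * (rad t * x) * h (rad t * x))%:E).
  exact: (measurableT_comp mH).
rewrite muleA -EFinM -ge0_integralZl_EFin//; last first.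
  by rewrite mulr_ge0// ?divr_ge0 ?addr_ge0 ?sqr_ge0// ltW.
apply: eq_integral => x _; rewrite /G /= -EFinM; congr EFin.
rewrite -rad2 (mulrC x); have r0 : rad t != 0 by rewrite gt_eqF.
have [x0|x0] := leP x 0.
  by rewrite !heaviside_le0 ?mul0r ?mulr0//; rewrite pmulr_rle0.
by rewrite !heaviside_gt0 ?mulr_gt0//; field.
Qed.

End sector_polar_coordinates.

Section measurable_sets.
Context d (T : measurableType d) (R : realType).
Implicit Types f g : T -> R.

Lemma measurable_set_ler f g : measurable_fun setT f -> measurable_fun setT g ->
  measurable [set x | f x <= g x].
Proof.
move=> mf mg; rewrite -[X in measurable X]setTI.
by apply: (measurable_fun_ler mf mg measurableT (Y := [set true])).
Qed.

Lemma measurable_set_ltr f g : measurable_fun setT f -> measurable_fun setT g ->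
  measurable [set x | f x < g x].
Proof.
move=> mf mg; rewrite -[X in measurable X]setTI.
by apply: (measurable_fun_ltr mf mg measurableT (Y := [set true])).
Qed.

End measurable_sets.

(** * The measure dA on sectors around the positive real axis *)

Section sectors.
Context {R : realType}.
Local Notation leb := (@lebesgue_measure R).
Local Notation plane := (measurableTypeR R * measurableTypeR R)%type.
Local Notation dA := (dA R).

(** The aperture is measured by the slope y / x, the angular variable of the polar formula above. *)
Definition sector (a tau : R) : set plane :=
  [set u | [/\ 0 < u.1, `|u.2| <= tau * u.1, a <= modc (toC u) &
               modc (toC u) < 1]].

Lemma measurable_modc : measurable_fun setT (fun u : plane => modc (toC u)).
Proof.
apply: (measurableT_comp measurable_sqrtr).
by apply: measurable_funD; exact: measurable_funX.
Qed.

Lemma measurable_discP : measurable (@discP R).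
Proof. by apply: measurable_set_ltr => //; exact: measurable_modc. Qed.

Lemma measurable_halfplane : measurable [set u : plane | 0 < u.1].
Proof. exact: measurable_set_ltr. Qed.

Lemma measurable_sector a tau : measurable (sector a tau).
Proof.
rewrite (_ : sector a tau = [set u | 0 < u.1] `&`
  [set u | `|u.2| <= tau * u.1] `&` [set u | a <= modc (toC u)] `&`
  [set u | modc (toC u) < 1]); last first.
  by apply/seteqP; split=> u /= [] => [? ? ? ?|[[? ?] ?] ?].
have mm := measurable_modc.
apply: measurableI; last exact: measurable_set_ltr.
apply: measurableI; last exact: measurable_set_ler.
apply: measurableI; first exact: measurable_halfplane.
apply: measurable_set_ler; first exact: measurableT_comp.
by apply: measurable_funM.
Qed.

Lemma ge0_integral_dA (D : set plane) (f : plane -> \bar R) : measurable D ->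
  measurable_fun D f -> (forall u, D u -> 0 <= f u)%E ->
  (\int[dA]_(u in D) f u = (pi^-1)%:E * \int[leb \x leb]_(u in D) f u)%E.
Proof. by move=> mD mf f0; rewrite ge0_integral_mscale. Qed.

Lemma ge0_integral_dA_polar (h k : R -> R) :
  measurable_fun setT h -> measurable_fun setT k ->
  (forall x, 0 <= h x) -> (forall x, 0 <= k x) ->
  (\int[dA]_(u in [set u | (0 < u.1)%R])
     (h (modc (toC u)) * k (u.2 / u.1))%R%:E =
   (pi^-1)%:E * ((\int[leb]_t (k t / (1 + t ^+ 2))%R%:E) *
   \int[leb]_(s in `]0%R, +oo[) (h s * s)%R%:E))%E.
Proof.
move=> mh mk h0 k0; rewrite ge0_integral_dA.
- by rewrite -ge0_integral_sector_polar.
- exact: measurable_halfplane.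
- apply: measurable_funTS; apply/measurable_EFinP; apply: measurable_funM.
    exact: (measurableT_comp mh measurable_modc).
  apply: (measurableT_comp mk); apply: measurable_funM => //.
  exact: (measurableT_comp measurable_invr).
- by move=> u _; rewrite lee_fin mulr_ge0.
Qed.

(** Polar coordinates with h an indicator and k = 1: the radial factor vanishes. This lets an almost
    everywhere statement about radii be used in the plane. *)
Lemma dA_radial_negligible (N : set R) : leb.-negligible N ->
  {ae dA, forall u, 0 < u.1 -> ~ N (modc (toC u))}.
Proof.
move=> [M [mM M0 NM]].
exists ([set u : plane | 0 < u.1] `&` (fun u => modc (toC u)) @^-1` M).
have mZ : measurable ([set u : plane | 0 < u.1] `&`
    (fun u => modc (toC u)) @^-1` M).
  apply: measurableI; first exact: measurable_halfplane.
  by rewrite -[X in measurable X]setTI; exact: measurable_modc.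
split=> //; last first.
  move=> u /= /not_implyP[u0 /contrapT Nu]; split=> //; exact: NM.
transitivity (\int[dA]_(u in [set u | (0 < u.1)%R])
    ((\1_M (modc (toC u)) : R) * cst 1 (u.2 / u.1))%R%:E)%E.
  rewrite -[LHS]mul1e -integral_cst// [LHS]integral_mkcondr.
  apply: eq_integral => u _; rewrite patchE mulr1 indicE.
  rewrite (_ : (u \in (fun u => modc (toC u)) @^-1` M) = (modc (toC u) \in M)).
    by case: ifPn.
  by apply/idP/idP => /set_mem/mem_set.
rewrite ge0_integral_dA_polar//.
rewrite [X in (_ * (_ * X))%E](_ : _ = 0%E) ?mule0//.
rewrite (_ : 0%E = \int[leb]_(s in `]0%R, +oo[) (cst 0%E s))%E; last first.
  by rewrite integral0.
apply: ge0_ae_eq_integral => //.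
- apply: measurable_funTS; apply/measurable_EFinP; apply: measurable_funM => //.
- by move=> x /=; rewrite in_itv/= andbT lee_fin => x0; rewrite mulr_ge0// ltW.
- exists M; split=> // x /= /not_implyP[_ Mx]; apply: contrapT => nMx.
  by apply: Mx; rewrite indicE memNset// mul0r.
Qed.

(** For |t| <= 1 the density 1 / (1 + t^2) lies between 1/2 and 1, and the interval has length 2
    tau. *)
Lemma integral_slope_bounds (tau : R) : 0 <= tau -> tau <= 1 ->
  (tau%:E <= \int[leb]_t (\1_(`[- tau, tau]%classic) t / (1 + t ^+ 2))%R%:E
     <= (2 * tau)%:E)%E.
Proof.
move=> tau0 tau1; have sq0 (t : R) : 0 < 1 + t ^+ 2 by rewrite ltr_wpDr ?sqr_ge0.
pose I : set R := `[- tau, tau]%classic.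
rewrite -/I; have mI' : measurable I by exact: measurable_itv.
have mI : measurable_fun setT (\1_I : R -> R) by exact: measurable_indic.
have E c : 0 <= c -> (\int[leb]_t (c * \1_I t)%R%:E = (c * (2 * tau))%:E)%E.
  move=> c0; under eq_integral do rewrite EFinM.
  rewrite ge0_integralZl_EFin//; last exact/measurable_EFinP.
  rewrite integral_indic//= setIT lebesgue_measure_itv/= lte_fin.
  have -> : 2 * tau = tau - - tau by ring.
  case: ltP => [_|]; first by rewrite -EFinD -EFinM.
  move=> taule; have -> : tau = 0 by lra.
  by rewrite mule0 opprK addr0 mulr0.
have mslope : measurable_fun setT (fun t : R => (\1_I t / (1 + t ^+ 2))%:E).
  apply/measurable_EFinP; apply: measurable_funM => //.
  apply: (measurableT_comp measurable_invr).
  by apply: measurable_funD => //; exact: measurable_funX.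
apply/andP; split.
  rewrite (_ : tau = 2^-1 * (2 * tau)); last by field.
  rewrite -E ?invr_ge0//; apply: ge0_le_integral => //.
  - by apply/measurable_EFinP; exact: (measurable_funM (measurable_cst _) mI).
  - move=> t _; rewrite lee_fin mulrC indicE.
    have [/set_mem|_] := boolP (t \in I); last by rewrite !mul0r.
    rewrite /I/= in_itv/= => /andP[t1 t2]; rewrite ler_wpM2l// lef_pV2 ?posrE//.
    nra.
rewrite -(mul1r (2 * tau)) -E//; apply: ge0_le_integral => //.
- by move=> t _; rewrite lee_fin divr_ge0// ltW.
- by apply/measurable_EFinP; exact: (measurable_funM (measurable_cst _) mI).
- move=> t _; rewrite lee_fin mul1r ler_pdivrMr// ler_peMr// lerDl sqr_ge0//.
Qed.

(** Since a >= 1/2, the Jacobian s lies between 1/2 and 1 on [a, 1[ and costs at most the factor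
    1/2; the angular factor costs between tau and 2 tau. *)
Lemma integral_sector_bounds (g : R -> R) (a tau : R) :
  measurable_fun setT g -> (forall x, 0 <= g x) ->
  2^-1 <= a -> 0 <= tau -> tau <= 1 ->
  ((tau / (2 * pi))%:E * \int[leb]_(s in `[a, 1%R[) (g s)%:E <=
   \int[dA]_(u in sector a tau) (g (modc (toC u)))%:E <=
   (2 * tau / pi)%:E * \int[leb]_(s in `[a, 1%R[) (g s)%:E)%E.
Proof.
move=> mg g0 a2 tau0 tau1.
have a0 : 0 < a by rewrite (lt_le_trans _ a2)// invr_gt0.
pose h s : R := \1_(`[a, 1[%classic) s * g s.
pose k : R -> R := \1_(`[- tau, tau]%classic).
have mh : measurable_fun setT h by apply: measurable_funM.
have mk : measurable_fun setT k by exact: measurable_indic.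
have h0 x : 0 <= h x by rewrite mulr_ge0.
have k0 x : 0 <= k x by [].
(* On the half-plane the indicator of the sector is a product of a function of the modulus and one
   of the slope. *)
rewrite (_ : \int[dA]_(u in sector a tau) _ =
    \int[dA]_(u in [set u | (0 < u.1)%R])
     (h (modc (toC u)) * k (u.2 / u.1))%R%:E)%E; last first.
  rewrite integral_mkcond [RHS]integral_mkcond; apply: eq_integral => u _.
  rewrite !patchE /h /k !indicE; case: ifPn => [/set_mem[u0 ut ua u1]|uS].
    rewrite mem_set//= mem_set/= ?in_itv/= ?ua//.
    rewrite mem_set/= ?mul1r ?mulr1//.
    by rewrite in_itv/= -ler_norml normrM normfV (gtr0_norm u0) ler_pdivrMr.
  case: ifPn => // /set_mem/= u0.
  have [/set_mem/=|_] := boolP (modc (toC u) \in _); last by rewrite !mul0r.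
  rewrite in_itv/= => /andP[ua u1].
  have [/set_mem/=|_] := boolP (_ / _ \in _); last by rewrite mulr0.
  rewrite in_itv/= -ler_norml normrM normfV (gtr0_norm u0) ler_pdivrMr// => ut.
  by rewrite mem_set in uS.
rewrite ge0_integral_dA_polar//.
have -> : (\int[leb]_(s in `]0%R, +oo[) (h s * s)%R%:E =
    \int[leb]_(s in `[a, 1%R[) (g s * s)%R%:E)%E.
  rewrite integral_mkcond [RHS]integral_mkcond; apply: eq_integral => s _.
  rewrite !patchE /h indicE; have [sa|sa] := boolP (s \in `[a, 1[%classic).
    rewrite mem_set ?mul1r//=; move/set_mem: sa; rewrite /= !in_itv/= andbT.
    by move=> /andP[+ _]; exact: lt_le_trans.
  by rewrite !mul0r if_same.
have /andP[lo hi] := integral_slope_bounds tau0 tau1.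
set K := (\int[leb]_t _)%E in lo hi *.
have pi0 : 0 <= (pi : R)^-1 by rewrite invr_ge0 pi_ge0.
have mgs : measurable_fun `[a, 1[ (fun s => (g s * s)%:E).
  by apply: measurable_funTS; apply/measurable_EFinP; apply: measurable_funM.
have mga : measurable_fun `[a, 1[ (fun s => (g s)%:E).
  by apply: measurable_funTS; apply/measurable_EFinP.
have J0 : (0 <= \int[leb]_(s in `[a, 1%R[) (g s * s)%R%:E)%E.
  apply: integral_ge0 => s /=; rewrite in_itv/= => /andP[sa _].
  by rewrite lee_fin mulr_ge0// (le_trans _ sa)// ltW.
have L0 : (0 <= \int[leb]_(s in `[a, 1%R[) (g s)%R%:E)%E.
  by apply: integral_ge0 => s _; rewrite lee_fin.
have JL : ((2^-1)%:E * \int[leb]_(s in `[a, 1%R[) (g s)%:E <=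
     \int[leb]_(s in `[a, 1%R[) (g s * s)%R%:E)%E.
  rewrite -ge0_integralZl_EFin//; last by move=> s _; rewrite lee_fin.
  apply: ge0_le_integral => //.
  - by move=> s _; rewrite lee_fin mulr_ge0.
  - by apply: measurable_funeM.
  - move=> s /=; rewrite in_itv/= => /andP[sa _].
    by rewrite lee_fin mulrC ler_wpM2l// (le_trans a2).
have JU : (\int[leb]_(s in `[a, 1%R[) (g s * s)%R%:E <=
     \int[leb]_(s in `[a, 1%R[) (g s)%:E)%E.
  apply: ge0_le_integral => //.
  - move=> s /=; rewrite in_itv/= => /andP[sa _].
    by rewrite lee_fin mulr_ge0// (le_trans _ sa)// ltW.
  - move=> s /=; rewrite in_itv/= => /andP[_ s1].
    by rewrite lee_fin ler_piMr// ltW.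
apply/andP; split.
  rewrite (_ : tau / (2 * pi) = pi^-1 * (tau * 2^-1)); last first.
    by rewrite invfM mulrA mulrC.
  rewrite EFinM -muleA lee_wpmul2l ?lee_fin//.
  by rewrite EFinM -muleA lee_pmul ?mule_ge0 ?lee_fin.
rewrite mulrC EFinM -muleA lee_wpmul2l ?lee_fin//.
by rewrite lee_pmul// (le_trans _ lo)// lee_fin.
Qed.

End sectors.

(** * Borel representatives of radial weights, and their mass on sectors *)

Section weights.
Context {R : realType}.
Local Notation leb := (@lebesgue_measure R).
Local Notation plane := (measurableTypeR R * measurableTypeR R)%type.
Local Notation dA := (dA R).
Local Open Scope complex_scope.
Implicit Types (w : R[i] -> R) (z : R[i]).

Lemma modc_ge0 (z : R[i]) : 0 <= modc z.
Proof. by case: z => x y; exact: sqrtr_ge0. Qed.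

Lemma modc_real (x : R) : 0 <= x -> modc x%:C = x.
Proof. by move=> x0; rewrite /modc /= expr0n/= addr0 sqrtr_sqr ger0_norm. Qed.

Lemma disc_real (s : R) : 0 <= s -> s < 1 -> disc s%:C.
Proof. by move=> s0 s1; rewrite /disc /mkset modc_real. Qed.

Lemma radial_weight_ge0 w (s : R) : radial_weight w -> 0 <= s -> s < 1 ->
  0 <= w s%:C.
Proof. by move=> [[w0 _] _ _ _ _] s0 s1; apply: w0; exact: disc_real. Qed.

(** The constant k is built into the last clause because linearity of the integral cannot be applied
    to w itself, only to its representative g. *)
Lemma radial_weight_borel w : radial_weight w ->
  exists g : R -> R, [/\ measurable_fun setT g, (forall x, 0 <= g x),
    {ae leb, forall s, `[0, 1[%classic s -> w s%:C = g s} &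
    forall k r, 0 <= k -> 0 <= r ->
    (\int[leb]_(s in `[r, 1%R[) (k * w s%:C)%:E =
     k%:E * \int[leb]_(s in `[r, 1%R[) (g s)%:E)%E].
Proof.
move=> ww; have [_ _ mw _ _] := ww.
have w0 s : `[0, 1[%classic s -> 0 <= w s%:C.
  by rewrite /= in_itv/= => /andP[s0 s1]; exact: radial_weight_ge0.
have [//|g [mg g0 wg]] := ge0_borel_representative _ mw w0.
exists g; split=> // k r k0 r0.
have sub s : `[r, 1[%classic s -> `[0, 1[%classic s.
  by rewrite /= !in_itv/= => /andP[rs ->]; rewrite (le_trans r0).
have mg' : measurable_fun `[r, 1[ (fun s => (g s)%:E).
  by apply: measurable_funTS; exact/measurable_EFinP.
rewrite -ge0_integralZl_EFin//; last by move=> s _; rewrite lee_fin.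
apply: ge0_ae_eq_integral_nonmeas => //.
- exact: measurable_funeM.
- by move=> s /sub/w0 ws; rewrite lee_fin mulr_ge0.
- by move=> s _; rewrite lee_fin mulr_ge0.
- by apply: filterS wg => s wg /sub/wg ->.
Qed.

Lemma integral_hatZ w (k : R) z : radial_weight w -> 0 <= k ->
  (\int[leb]_(s in `[modc z, 1%R[) (k * w s%:C)%:E = k%:E * hat w z)%E.
Proof.
move=> ww k0; have [g [mg g0 _ wg]] := radial_weight_borel ww.
have z0 := modc_ge0 z.
rewrite wg// /hat; congr (_ * _)%E; rewrite -[LHS]mul1e -wg//.
by apply: eq_integral => s _; rewrite mul1r.
Qed.

Lemma hat_borel w (g : R -> R) : radial_weight w ->
  (forall k r, 0 <= k -> 0 <= r ->
    (\int[leb]_(s in `[r, 1%R[) (k * w s%:C)%:E =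
     k%:E * \int[leb]_(s in `[r, 1%R[) (g s)%:E)%E) ->
  forall z, (hat w z = \int[leb]_(s in `[modc z, 1%R[) (g s)%:E)%E.
Proof.
move=> ww wg z; rewrite -[LHS]mul1e -integral_hatZ// wg ?modc_ge0//.
by rewrite mul1e.
Qed.

Lemma hat_le w (z z' : R[i]) : radial_weight w -> modc z <= modc z' ->
  (hat w z' <= hat w z)%E.
Proof.
move=> ww zz'; have [g [mg g0 _ /(hat_borel ww) wg]] := radial_weight_borel ww.
rewrite !wg; apply: ge0_subset_integral => //.
- by apply: measurable_funTS; exact/measurable_EFinP.
- by move=> s _; rewrite lee_fin.
- by move=> s /=; rewrite !in_itv/= => /andP[zs ->]; rewrite (le_trans zz').
Qed.

Lemma hat_gt0 w z : radial_weight w -> disc z -> (0 < hat w z)%E.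
Proof. by move=> [_ _ _ + _]; apply. Qed.

Lemma hat_fin_num w z : radial_weight w -> disc z -> hat w z \is a fin_num.
Proof.
move=> ww zd; rewrite ge0_fin_numE; last exact/ltW/hat_gt0.
have [_ _ _ _] := ww; apply: le_lt_trans; apply: hat_le => //.
by rewrite modc_real ?modc_ge0.
Qed.

(** Two representatives have to be reconciled: G of w on the disc, for area integrals, and g of its
    profile on [0, 1[, for [hat]. Radiality of w makes g(|u|) and G(u) agree almost everywhere on
    sectors. *)
Lemma weight_disc_borel w : radial_weight w ->
  exists G : plane -> R, [/\ measurable_fun setT G, (forall u, 0 <= G u),
    forall phi : plane -> R, measurable_fun setT phi -> (forall u, 0 <= phi u) ->
      (\int[dA]_(u in @discP R) (phi u * w (toC u))%:E =
       \int[dA]_(u in @discP R) (phi u * G u)%:E)%E,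
    (\int[dA]_(u in @discP R) (G u)%:E < +oo)%E &
    forall a tau, 2^-1 <= a -> 0 <= tau -> tau <= 1 ->
      ((tau / (2 * pi))%:E * hat w a%:C <= \int[dA]_(u in sector a tau) (G u)%:E
      <= (2 * tau / pi)%:E * hat w a%:C)%E].
Proof.
move=> ww; have [[w0 [mw wfin]] wrad _ _ _] := ww.
have [g [mg g0 wg /(hat_borel ww) hatg]] := radial_weight_borel ww.
have w0' u : @discP R u -> 0 <= (w \o @toC R) u by exact: w0.
have [G [mG G0 wG]] := ge0_borel_representative (@measurable_discP R) mw w0'.
have mdisc := @measurable_discP R.
exists G; split => //.
- move=> phi mphi phi0; apply: ge0_ae_eq_integral_nonmeas => //.
  + apply: measurable_funTS; apply/measurable_EFinP; exact: measurable_funM.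
  + by move=> u /w0' wu; rewrite lee_fin mulr_ge0.
  + by move=> u _; rewrite lee_fin mulr_ge0.
  + by apply: filterS wG => u /= wG /wG <-.
- apply: le_lt_trans wfin.
  rewrite [leRHS](@ge0_ae_eq_integral_nonmeas _ _ _ _ _ _ (fun u => (G u)%:E))//.
  + by apply: measurable_funTS; exact/measurable_EFinP.
  + by move=> u _; rewrite lee_fin.
  + apply: filterS wG => u /= wG du; rewrite ger0_norm; last exact: w0'.
    by rewrite -wG.
- move=> a tau a2 tau0 tau1; have a0 : 0 <= a by rewrite (le_trans _ a2).
  have sector_disc u : sector a tau u -> @discP R u by case.
  have <- : (\int[dA]_(u in sector a tau) (g (modc (toC u)))%:E =
      \int[dA]_(u in sector a tau) (G u)%:E)%E.
    apply: ge0_ae_eq_integral => //.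
    + exact: measurable_sector.
    + apply: measurable_funTS; apply/measurable_EFinP.
      exact: (measurableT_comp mg (@measurable_modc R)).
    + by apply: measurable_funTS; apply/measurable_EFinP.
    + by move=> u _; rewrite lee_fin.
    + by move=> u _; rewrite lee_fin.
    + have gN := dA_radial_negligible wg.
      apply: (filterS2 (ae_filter_ringOfSetsType dA) _ gN wG) => u {}gN {}wG [u0 ut ua u1].
      have := wG u1; rewrite /= wrad// => <-; congr EFin; apply/esym.
      (* [wg] says that the radii where w and g differ form a negligible set, so [gN] yields a
         double negation. *)
      have /contrapT := gN u0; apply.
      by apply/andP; split; [exact: modc_ge0|exact: u1].
  rewrite hatg modc_real//; exact: integral_sector_bounds.
Qed.

End weights.

(** * Elementary inequalities for dyadic numbers, powers and the modulus *)

Section dyadic.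
Context {R : realType}.
Local Open Scope complex_scope.
Implicit Types (N : nat) (m : R).

Lemma dyadic_gt0 N : 0 < 2 ^- N :> R.
Proof. by rewrite invr_gt0 exprn_gt0. Qed.

Lemma dyadicS N : 2 ^- N.+1 = 2^-1 * 2 ^- N :> R.
Proof. by rewrite exprS invfM. Qed.

Lemma dyadic_le_half N : (0 < N)%N -> 2 ^- N <= 2^-1 :> R.
Proof.
case: N => // N _; rewrite dyadicS ler_piMr ?invr_ge0//.
by rewrite invf_le1 ?exprn_gt0// exprn_ege1// ler1n.
Qed.

Lemma powRN_le m (a b : R) : 0 <= m -> 0 < a -> a <= b -> b `^ (- m) <= a `^ (- m).
Proof.
move=> m0 a0 ab; have b0 := lt_le_trans a0 ab.
by rewrite !powRN lef_pV2 ?posrE ?powR_gt0// ge0_ler_powR// nnegrE ltW.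
Qed.

(** From 2^m = exp(m ln 2) >= 1 + m ln 2. *)
Lemma powR2_ge m (c : R) : c / ln 2 <= m -> c <= 2 `^ m.
Proof.
have l0 : 0 < ln 2 :> R by rewrite ln_gt0// ltr1n.
rewrite ler_pdivrMr// => cm; rewrite (le_trans cm)//.
rewrite /powR pnatr_eq0/= (le_trans _ (expR_ge1Dx _))// lerDr//.
Qed.

Lemma modc_ge_Re (x y : R) : `|x| <= modc (x +i* y).
Proof. by rewrite /modc/= -sqrtr_sqr ler_wsqrtr// lerDl sqr_ge0. Qed.

Lemma modc_ge_Im (x y : R) : `|y| <= modc (x +i* y).
Proof. by rewrite /modc/= -sqrtr_sqr ler_wsqrtr// lerDr sqr_ge0. Qed.

End dyadic.

(** * Upper bound for the kernel integral, by induction on the dyadic level *)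

Section kernel_estimate.
Context {R : realType}.
Local Notation plane := (measurableTypeR R * measurableTypeR R)%type.
Local Notation dA := (dA R).
Local Open Scope complex_scope.

Definition dyadic_hat (nu : R[i] -> R) (N : nat) : R :=
  fine (hat nu (1 - 2 ^- N)%:C).

(** With m = np this dominates |f|^p up to the factor 2^m. Unlike |1 - a z|^-m, it does not change
    from level N to N + 1 where |1 - z| > 2^-N. *)
Definition dyadic_kernel (m : R) (N : nat) (u : plane) : R :=
  Num.max (2 ^- N) (modc (1 - toC u)) `^ (- m).

Lemma dyadic_radius (N : nat) : 0 <= 1 - 2 ^- N :> R /\ 1 - 2 ^- N < 1 :> R.
Proof.
split; last by rewrite ltrBlDr ltrDl dyadic_gt0.
by rewrite subr_ge0 invf_le1 ?exprn_gt0// exprn_ege1// ler1n.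
Qed.

Lemma disc_dyadic (N : nat) : disc (1 - 2 ^- N : R)%:C.
Proof. by have [? ?] := dyadic_radius N; exact: disc_real. Qed.

Section properties_of_dyadic_hat.
Variables (nu : R[i] -> R).
Hypothesis hnu : radial_weight nu.

Lemma dyadic_hatE N : (hat nu (1 - 2 ^- N)%:C = (dyadic_hat nu N)%:E)%E.
Proof. by rewrite fineK// hat_fin_num//; exact: disc_dyadic. Qed.

Lemma dyadic_hat_gt0 N : 0 < dyadic_hat nu N.
Proof. by rewrite -lte_fin -dyadic_hatE hat_gt0//; exact: disc_dyadic. Qed.

Lemma dyadic_hat_le0 N : dyadic_hat nu N <= dyadic_hat nu 0.
Proof.
rewrite -lee_fin -!dyadic_hatE; apply: hat_le => //.
have [? ?] := dyadic_radius N; have [? ?] := dyadic_radius 0.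
by rewrite !modc_real// expr0 invr1 subrr.
Qed.

End properties_of_dyadic_hat.

Lemma dyadic_hat_doubling nu : Dhat nu -> exists2 C : R, 1 < C &
  forall N, dyadic_hat nu N <= C * dyadic_hat nu N.+1.
Proof.
move=> [hnu [C C1 hC]]; exists C => // N.
have [r0 r1] := dyadic_radius N.
rewrite -lee_fin EFinM -!dyadic_hatE//; have := hC _ r0 r1.
by rewrite (_ : (1 + (1 - 2 ^- N)) / 2 = 1 - 2 ^- N.+1)// dyadicS; field.
Qed.

Lemma measurable_dyadic_kernel m N : measurable_fun setT (dyadic_kernel m N).
Proof.
apply: (measurableT_comp (@measurable_powR R (- m))).
apply: measurable_maxr => //.
have -> : (fun u => modc (1 - toC u)) =
    (fun u : plane => Num.sqrt ((1 - u.1) ^+ 2 + (- u.2) ^+ 2)).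
  by apply/funext => u; rewrite /modc/= sub0r.
apply: (measurableT_comp measurable_sqrtr); apply: measurable_funD.
  by apply: measurable_funX; exact: measurable_funB.
by apply: measurable_funX; exact: measurableT_comp.
Qed.

Lemma dyadic_kernel_ge0 m N u : 0 <= dyadic_kernel m N u.
Proof. exact: powR_ge0. Qed.

(** Here |y| <= 2^-N, and x >= 1/2 turns this into the slope bound; hence the factor 2 in the
    aperture. *)
Lemma near1_sector N (u : plane) : (0 < N)%N -> @discP R u ->
  modc (1 - toC u) <= 2 ^- N -> sector (1 - 2 ^- N) (2 * 2 ^- N) u.
Proof.
case: u => x y N0 du dle; have d2 := @dyadic_le_half R N N0.
have d0 := @dyadic_gt0 R N.
have eq1 : 1 - toC (x, y) = (1 - x) +i* (- y).
  by rewrite /toC/=; apply/eqP; rewrite eq_complex/= sub0r !eqxx.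
rewrite eq1 in dle.
have := le_trans (modc_ge_Re _ _) dle; rewrite ler_norml => /andP[_ x1].
have := le_trans (modc_ge_Im _ _) dle; rewrite normrN => y1.
have x2 : 2^-1 <= x by lra.
split => //=.
- lra.
- by rewrite (le_trans y1)//; nra.
- have := modc_ge_Re x y; rewrite ger0_norm; last lra.
  by apply: le_trans; lra.
Qed.

Lemma dyadic_kernelS m N (u : plane) : 0 <= m -> (0 < N)%N -> @discP R u ->
  dyadic_kernel m N.+1 u <= dyadic_kernel m N u +
    (2 ^- N.+1) `^ (- m) * \1_(sector (1 - 2 ^- N) (2 * 2 ^- N)) u.
Proof.
move=> m0 N0 du; have d0 := @dyadic_gt0 R N; have d1 := @dyadic_gt0 R N.+1.
have [uN|uN] := leP (modc (1 - toC u)) (2 ^- N).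
  rewrite indicE mem_set; last exact: near1_sector.
  rewrite mulr1 (le_trans _ (ler_wpDl _ (lexx _)))// ?dyadic_kernel_ge0//.
  by apply: powRN_le => //; rewrite le_max lexx.
rewrite ler_wpDr ?mulr_ge0 ?powR_ge0//.
rewrite /dyadic_kernel !max_r//; first exact: ltW.
by rewrite (le_trans _ (ltW uN))// dyadicS ler_piMl ?invf_le1 ?ler1n// ltW.
Qed.

Lemma dyadic_kernel_integral_bound nu : Dhat nu -> exists m0 : R, forall m,
  0 <= m -> m0 <= m -> exists2 K : R, 0 < K & forall N, (0 < N)%N ->
  (\int[dA]_(u in @discP R) (dyadic_kernel m N u * nu (toC u))%:E <=
   (K * (2 ^- N) `^ (- m) * (2 ^- N * dyadic_hat nu N))%:E)%E.
Proof.
move=> Dnu; have hnu := Dnu.1; have [C C1 hC] := dyadic_hat_doubling Dnu.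
have C0 : 0 < C by rewrite (lt_trans _ C1).
have [G [mG G0 intG Gfin secG]] := weight_disc_borel hnu.
(* The threshold gives 2^m >= 4C, twice the loss 2C of [vS]. *)
exists (4 * C / ln 2) => m m0 /powR2_ge mC.
pose D := @discP R; have mD : measurable D by exact: measurable_discP.
have D0 : (0 <= \int[dA]_(u in D) (G u)%:E)%E.
  by apply: integral_ge0 => u _; rewrite lee_fin.
have [M ME] : exists M, (\int[dA]_(u in D) (G u)%:E = M%:E)%E.
  by exists (fine (\int[dA]_(u in D) (G u)%:E)); rewrite fineK// ge0_fin_numE.
have mGD : measurable_fun D (fun u => (G u)%:E).
  by apply: measurable_funTS; apply/measurable_EFinP.
have M0 : 0 <= M by rewrite -lee_fin -ME.
pose v N := 2 ^- N * dyadic_hat nu N.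
have v0 N : 0 < v N by rewrite mulr_gt0 ?dyadic_gt0 ?dyadic_hat_gt0.
have vS N : v N <= 2 * C * v N.+1.
  rewrite /v dyadicS (_ : 2 * C * _ = 2 ^- N * (C * dyadic_hat nu N.+1)).
    by rewrite ler_wpM2l ?hC// ltW// dyadic_gt0.
  by field.
have K1 : 0 < 4 / pi :> R by rewrite divr_gt0 ?pi_gt0.
(* The first summand closes the induction step, the second covers the base case. *)
pose K := 4 * C * (4 / pi) + M / v 1.
have Cq : 0 < 4 * C * (4 / pi) by apply: mulr_gt0 => //; exact: mulr_gt0.
have K0 : 0 < K by apply: ltr_pwDl => //; rewrite divr_ge0// ltW.
exists K => // N N0; rewrite intG; last 2 first.
- exact: measurable_dyadic_kernel.
- exact: dyadic_kernel_ge0.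
(* The induction starts at N = 1, because the sector bounds need 1 - 2^-N >= 1/2. *)
case: N N0 => // N _.
have mk n : measurable_fun D (fun u => (dyadic_kernel m n u * G u)%:E).
  apply: measurable_funTS; apply/measurable_EFinP; apply: measurable_funM => //.
  exact: measurable_dyadic_kernel.
elim: N => [|N IH].
  rewrite (@le_trans _ _ (((2 ^- 1) `^ (- m))%:E * M%:E)%E)//.
    rewrite -ME -(ge0_integralZl_EFin _ mD _ mGD (powR_ge0 _ _)); last first.
      by move=> u _; rewrite lee_fin.
    apply: ge0_le_integral => //.
    - by move=> u _; rewrite lee_fin mulr_ge0// dyadic_kernel_ge0.
    - exact: measurable_funeM.
    - move=> u _; rewrite lee_fin ler_wpM2r// powRN_le ?dyadic_gt0//.
      by rewrite le_max lexx.
  rewrite -EFinM lee_fin -mulrA mulrCA ler_wpM2l ?powR_ge0//.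
  rewrite -/(v 1) /K mulrDl divfK ?gt_eqF// lerDr; apply: mulr_ge0; exact: ltW.
pose d : R := 2 ^- N.+2; rewrite -/d.
pose S : set plane := sector (1 - 2 ^- N.+1) (2 * 2 ^- N.+1).
have d0 : 0 < d by exact: dyadic_gt0.
have mS : measurable S by exact: measurable_sector.
have E1 : (\int[dA]_(u in D) (dyadic_kernel m N.+2 u * G u)%:E <=
    \int[dA]_(u in D) (dyadic_kernel m N.+1 u * G u)%:E +
    (d `^ (- m))%:E * \int[dA]_(u in S) (G u)%:E)%E.
  have -> : (\int[dA]_(u in S) (G u)%:E = \int[dA]_(u in D) (\1_S u * G u)%:E)%E.
    rewrite integral_mkcond [RHS]integral_mkcond; apply: eq_integral => u _.
    rewrite !patchE indicE; have [uS|_] := boolP (u \in S).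
      by rewrite mul1r mem_set//; have [] := set_mem uS.
    by rewrite mul0r if_same.
  have mSG : measurable_fun D (fun u => (\1_S u * G u)%:E).
    apply: measurable_funTS; apply/measurable_EFinP; apply: measurable_funM => //.
  rewrite -ge0_integralZl_EFin ?powR_ge0//; last first.
    by move=> u _; rewrite lee_fin mulr_ge0.
  rewrite -ge0_integralD//.
  - apply: ge0_le_integral => //.
    + by move=> u _; rewrite lee_fin mulr_ge0// dyadic_kernel_ge0.
    + by apply: emeasurable_funD => //; exact: measurable_funeM.
    + move=> u du; rewrite -EFinM -EFinD lee_fin mulrA -mulrDl ler_wpM2r//.
      exact: dyadic_kernelS.
  - by move=> u _; rewrite lee_fin mulr_ge0// dyadic_kernel_ge0.
  - by move=> u _; rewrite lee_fin mulr_ge0 ?powR_ge0// mulr_ge0.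
  - exact: measurable_funeM.
have d2 := @dyadic_le_half R N.+1 erefl.
have dN := @dyadic_gt0 R N.+1.
(* 4 / pi comes from 2 tau / pi with slope tau = 2 * 2^-(N+1). *)
have E2 : (\int[dA]_(u in S) (G u)%:E <= (4 / pi * v N.+1)%:E)%E.
  have rearrange (e t h : R) : 2 * (2 * e) * t * h = 4 * t * (e * h) by ring.
  have t0 : 0 <= 2 * 2 ^- N.+1 :> R by rewrite mulr_ge0// ltW.
  have t1 : 2 * 2 ^- N.+1 <= 1 :> R by rewrite mulrC -ler_pdivlMr// mul1r.
  have a2 : 2^-1 <= 1 - 2 ^- N.+1 :> R.
    by move: d2; clear; set e := 2 ^- N.+1; move: e => e ?; lra.
  have /andP[_] := secG _ _ a2 t0 t1.
  rewrite dyadic_hatE// -EFinM; move/le_trans; apply; rewrite lee_fin /v.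
  by rewrite rearrange.
apply: (le_trans E1); apply: le_trans.
  apply: leeD; first exact: IH.
  by apply: lee_wpmul2l E2; rewrite lee_fin powR_ge0.
rewrite -EFinM -EFinD lee_fin -/(v N.+1) -/(v N.+2).
have B0 : 0 < 2 `^ m :> R by rewrite powR_gt0.
have -> : (2 ^- N.+1) `^ (- m) = (2 `^ m)^-1 * d `^ (- m).
  rewrite -powRN -powRM// ?ltW//; congr (_ `^ _).
  by rewrite /d [in RHS]dyadicS mulrA divff ?mul1r.
have A0 : 0 < d `^ (- m) by rewrite powR_gt0.
have KB : K * (2 `^ m)^-1 <= K / (4 * C).
  by rewrite ler_wpM2l ?(ltW K0)// lef_pV2 ?posrE// mulr_gt0.
have Kq : 4 * C * (4 / pi) <= K by rewrite lerDl divr_ge0// ltW.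
move: (d `^ (- m)) A0 (v N.+1) (v0 N.+1) (v N.+2) (v0 N.+2) (vS N.+1).
move=> A A0 v1 v10 v2 v20 v12; move: (4 / pi) K1 Kq => q q0 Kq.
rewrite (_ : _ + _ = A * ((K / 2 `^ m + q) * v1)); last by ring.
rewrite [leRHS](_ : _ = A * (K * v2)); last by ring.
rewrite ler_wpM2l ?(ltW A0)//.
(* The old kernel contributes K/2 and the sector 2 C q, which is at most K/2 by [Kq]. *)
rewrite (@le_trans _ _ ((K / (4 * C) + q) * (2 * C * v2)))//.
  by rewrite ler_pM// ?(ltW v10)// ?lerD2r// addr_ge0// ?ltW// divr_gt0.
rewrite [leLHS](_ : _ = (2^-1 * K + 2^-1 * (4 * C * q)) * v2); last first.
  by field; rewrite gt_eqF.
rewrite ler_wpM2r ?(ltW v20)//; lra.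
Qed.

End kernel_estimate.

(** * The modulus, and the real part of an n-th power near the real axis *)

Section complex_modulus.
Context {R : realType}.
Local Open Scope complex_scope.
Implicit Types (z w : R[i]) (x y : R) (n : nat).

Lemma modcM z w : modc (z * w) = modc z * modc w.
Proof. exact: ComplexField.Normc.normcM. Qed.

Lemma modcV z : modc z^-1 = (modc z)^-1.
Proof. exact: ComplexField.Normc.normcV. Qed.

Lemma modcX z n : modc (z ^+ n) = modc z ^+ n.
Proof.
elim: n => [|n IH]; last by rewrite !exprS modcM IH.
by rewrite !expr0; exact: ComplexField.Normc.normc1.
Qed.

Lemma modcN z : modc (- z) = modc z.
Proof. exact: normcN. Qed.

Lemma modcD z w : modc (z + w) <= modc z + modc w.
Proof. exact: le_normcD. Qed.

Lemma modcR x : modc x%:C = `|x|.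
Proof. by rewrite /modc /= expr0n /= addr0 sqrtr_sqr. Qed.

Lemma Re_le_modc z : complex.Re z <= modc z.
Proof. by case: z => x y; rewrite (le_trans (ler_norm _))// modc_ge_Re. Qed.

(** Induction through z^(n+1) - 1 = z (z^n - 1) + (z - 1). *)
Lemma modc_expr_sub1 z n : modc z <= 1 ->
  modc (z ^+ n - 1) <= n%:R * modc (z - 1).
Proof.
move=> z1; elim: n => [|n IH].
  by rewrite expr0 subrr mul0r (modcR 0) normr0.
rewrite (_ : _ - 1 = z * (z ^+ n - 1) + (z - 1)); last by rewrite exprS; ring.
rewrite (le_trans (modcD _ _))// -natr1 mulrDl mul1r lerD2r modcM.
by rewrite (le_trans _ IH)// ler_piMl// modc_ge0.
Qed.

Lemma Re_mulR x z : complex.Re (x%:C * z) = x * complex.Re z.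
Proof. by case: z => a b /=; rewrite mul0r subr0. Qed.

(* With u + iv = u (1 + i eta) and zeta = 1 / (1 + i eta), one has |zeta| <= 1
   and |zeta - 1| <= |eta|, hence |zeta^n - 1| <= n |eta| <= 1/2. *)
Lemma Re_inv_exprn_ge (u v : R) n : 0 < u -> (2 * n%:R) * `|v| <= u ->
  (2 * u ^+ n)^-1 <= complex.Re ((u +i* v)^-1 ^+ n).
Proof.
move=> u0 vu; pose eta := v / u.
have un0 : u != 0 by rewrite gt_eqF.
pose w := 1 +i* eta; pose zeta := w^-1.
have uvE : u +i* v = u%:C * w.
  apply/eqP; rewrite eq_complex /= !mul0r subr0 mulr1 addr0 eqxx/=.
  by rewrite /eta mulrC divfK.
have w1 : 1 <= modc w by rewrite (le_trans _ (modc_ge_Re 1 eta))// normr1.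
have w0 : w != 0.
  by apply: contraTneq w1 => ->; rewrite (modcR 0) normr0 -ltNge ltr01.
have zeta1 : modc zeta <= 1.
  by rewrite modcV invf_le1// (lt_le_trans _ w1).
have zeta_eta : modc (zeta - 1) <= `|eta|.
  have -> : zeta - 1 = zeta * (- (0 +i* eta)).
    have -> : - (0 +i* eta) = 1 - w.
      by apply/eqP; rewrite eq_complex /= subrr sub0r oppr0 !eqxx.
    by rewrite mulrBr mulr1 /zeta mulVf.
  rewrite modcM modcN /modc /= -/(modc zeta) expr0n /= add0r sqrtr_sqr.
  by rewrite ler_piMl.
have half : modc (zeta ^+ n - 1) <= 2^-1.
  rewrite (le_trans (modc_expr_sub1 _ zeta1))//.
  rewrite (@le_trans _ _ (n%:R * `|eta|))//; first by rewrite ler_wpM2l.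
  rewrite /eta normrM normfV (gtr0_norm u0) mulrA ler_pdivrMr//; lra.
have Rez : 2^-1 <= complex.Re (zeta ^+ n).
  have := le_trans (Re_le_modc (1 - zeta ^+ n)) _.
  move=> /(_ 2^-1); rewrite -[X in modc X]opprB modcN => /(_ half).
  rewrite raddfB /=; lra.
rewrite uvE [(u%:C * w)^-1]invfM exprMn -/zeta -(fmorphV (real_complex R)) -rmorphXn/= Re_mulR.
by rewrite exprVn invfM mulrC ler_wpM2l// invr_ge0 exprn_ge0// ltW.
Qed.

End complex_modulus.

(** * Measurability of complex-valued functions *)

Section complex_measurability.
Context d (T : measurableType d) (R : realType).
Implicit Types f g : T -> R[i].

(** Stated componentwise to match [in_Lw], which treats real and imaginary parts separately. *)
Definition cmeasurable f : Prop :=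
  measurable_fun setT (@complex.Re R \o f) /\ measurable_fun setT (@complex.Im R \o f).

Lemma cmeasurable_cst c : cmeasurable (fun=> c).
Proof. by split; exact: measurable_cst. Qed.

Lemma cmeasurableB f g : cmeasurable f -> cmeasurable g ->
  cmeasurable (fun x => f x - g x).
Proof.
move=> [mf1 mf2] [mg1 mg2]; split.
  rewrite (_ : _ \o _ = (@complex.Re R \o f) \- (@complex.Re R \o g)).
    exact: measurable_funB.
  by apply/funext => x /=; case: (f x) (g x) => [? ?] [].
rewrite (_ : _ \o _ = (@complex.Im R \o f) \- (@complex.Im R \o g)).
  exact: measurable_funB.
by apply/funext => x /=; case: (f x) (g x) => [? ?] [].
Qed.

Lemma cmeasurableM f g : cmeasurable f -> cmeasurable g ->
  cmeasurable (fun x => f x * g x).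
Proof.
move=> [mf1 mf2] [mg1 mg2]; split.
  rewrite (_ : _ \o _ = ((@complex.Re R \o f) \* (@complex.Re R \o g)) \-
                        ((@complex.Im R \o f) \* (@complex.Im R \o g))).
    by apply: measurable_funB; exact: measurable_funM.
  by apply/funext => x /=; case: (f x) (g x) => [? ?] [].
rewrite (_ : _ \o _ = ((@complex.Re R \o f) \* (@complex.Im R \o g)) \+
                      ((@complex.Im R \o f) \* (@complex.Re R \o g))).
  by apply: measurable_funD; exact: measurable_funM.
by apply/funext => x /=; case: (f x) (g x) => [? ?] [].
Qed.

Lemma cmeasurableV f : cmeasurable f -> cmeasurable (fun x => (f x)^-1).
Proof.
move=> [mf1 mf2].
have mN : measurable_fun setT
    (fun x => (complex.Re (f x) ^+ 2 + complex.Im (f x) ^+ 2)^-1).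
  apply: (measurableT_comp measurable_invr).
  by apply: measurable_funD; exact: measurable_funX.
split.
  rewrite (_ : _ \o _ = (@complex.Re R \o f) \*
      (fun x => (complex.Re (f x) ^+ 2 + complex.Im (f x) ^+ 2)^-1)).
    exact: measurable_funM.
  by apply/funext => x /=; case: (f x).
rewrite (_ : _ \o _ = (\- (@complex.Im R \o f)) \*
    (fun x => (complex.Re (f x) ^+ 2 + complex.Im (f x) ^+ 2)^-1)).
  by apply: measurable_funM => //; exact: measurable_funN.
by apply/funext => x /=; case: (f x) => a b /=; rewrite mulNr.
Qed.

Lemma cmeasurableX f n : cmeasurable f -> cmeasurable (fun x => f x ^+ n).
Proof.
move=> mf; elim: n => [|n IH].
  by under eq_fun do rewrite expr0; exact: cmeasurable_cst.
by under eq_fun do rewrite exprS; exact: cmeasurableM.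
Qed.

End complex_measurability.

(** * The test functions and their two-sided estimates *)

Section test_functions.
Context {R : realType}.
Local Notation leb := (@lebesgue_measure R).
Local Notation plane := (measurableTypeR R * measurableTypeR R)%type.
Local Notation dA := (dA R).
Local Open Scope complex_scope.
Variables (n N : nat).

Local Notation dl := (2 ^- N : R).

Definition test_fun (z : R[i]) : R[i] := (1 - (1 - dl)%:C * z)^-1 ^+ n.

(** First |1 - a z| >= 1 - a = d; then 1 - z = (1 - a z) - d z gives |1 - z| <= |1 - a z| + d <= 2
    |1 - a z|. *)
Lemma test_fun_denominator z : disc z ->
  dl <= modc (1 - (1 - dl)%:C * z) /\
  Num.max dl (modc (1 - z)) <= 2 * modc (1 - (1 - dl)%:C * z).
Proof.
move=> z1; set w := _ - _; have [a0 a1] := @dyadic_radius R N.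
have z0 := modc_ge0 z; have d0 := @dyadic_gt0 R N.
have dw : dl <= modc w.
  have := modcD w ((1 - dl)%:C * z); rewrite subrK modcM (modcR 1) normr1.
  rewrite modcR ger0_norm//.
  have : (1 - dl) * modc z <= 1 - dl by rewrite ler_piMr// ltW.
  lra.
split=> //.
have : modc (1 - z) <= 2 * modc w.
  have -> : 1 - z = w - dl%:C * z.
    by rewrite /w rmorphB /= mulrBl mul1r; ring.
  rewrite (le_trans (modcD _ _))// modcN modcM modcR ger0_norm ?(ltW d0)//.
  have : dl * modc z <= dl by rewrite ler_piMr// ltW.
  lra.
rewrite ge_max => ->; rewrite andbT (le_trans dw)//; lra.
Qed.

Lemma test_fun_analytic : analytic_on_disc test_fun.
Proof.
move=> z zd.
have [dw _] := test_fun_denominator zd.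
have w0 : 1 - (1 - dl)%:C * z != 0.
  apply: contraTneq dw => ->.
  by rewrite (modcR 0) normr0 -ltNge dyadic_gt0.
have dc (c : R[i]) : derivable (cst c : R[i]^o -> R[i]^o) (z : R[i]^o) 1.
  exact: derivable_cst.
have di : derivable (id : R[i]^o -> R[i]^o) (z : R[i]^o) 1.
  exact: derivable_id.
have dv := @derivableV _ _ _ _ _ w0
  (derivableB (dc 1) (derivableM (dc (1 - dl)%:C) di)).
have := @derivableX _ _ _ n _ _ dv; set g := (X in derivable X _ _).
have -> : g = test_fun by apply/funext => y; rewrite /g exprfctE; reflexivity.
exact.
Qed.

Lemma cmeasurable_test_fun : cmeasurable (fun u : plane => test_fun (toC u)).
Proof.
apply: cmeasurableX; apply: cmeasurableV; apply: cmeasurableB.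
  exact: cmeasurable_cst.
apply: cmeasurableM; first exact: cmeasurable_cst.
by split; [exact: measurable_fst|exact: measurable_snd].
Qed.

Lemma modc_test_fun_powR (p : R) z : 0 <= p -> disc z ->
  modc (test_fun z) `^ p <= 2 `^ (n%:R * p) *
    Num.max dl (modc (1 - z)) `^ (- (n%:R * p)).
Proof.
move=> p0 zd; have [dw mw] := test_fun_denominator zd.
set w := 1 - _ in dw mw *; have d0 := @dyadic_gt0 R N.
have w0 : 0 < modc w by exact: lt_le_trans dw.
rewrite /test_fun -/w modcX modcV -powR_mulrn ?invr_ge0 ?modc_ge0//.
rewrite -powRrM -powR_inv1 ?modc_ge0// -powRrM mulN1r.
have m0 : 0 <= n%:R * p by rewrite mulr_ge0.
rewrite !powRN ler_pdivlMr ?powR_gt0 ?lt_max ?d0//.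
rewrite ler_pdivrMl ?powR_gt0// mulrC -powRM ?modc_ge0//.
apply: ge0_ler_powR.
- by rewrite mulrC.
- by rewrite nnegrE le_max ltW.
- by rewrite nnegrE mulr_ge0// ltW.
- by rewrite mulrC.
Qed.

Lemma modc_test_fun_le z : disc z -> modc (test_fun z) <= dl^-1 ^+ n.
Proof.
move=> zd; have [dw _] := test_fun_denominator zd.
have d0 := @dyadic_gt0 R N.
have w0 := lt_le_trans d0 dw.
rewrite /test_fun modcX modcV; apply: lerXn2r.
- by rewrite nnegrE invr_ge0 ltW.
- by rewrite nnegrE invr_ge0 ltW.
- by rewrite lef_pV2.
Qed.

(** The real part U of 1 - a z lies in [d, 3d], and its imaginary part is at most d / 2n in absolute
    value by the choice of the aperture, as [Re_inv_exprn_ge] requires. *)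
Lemma Re_test_fun_ge (u : plane) : (0 < n)%N ->
  sector (1 - dl) (dl / (2 * n%:R)) u ->
  (2 * (3 * dl) ^+ n)^-1 <= complex.Re (test_fun (toC u)).
Proof.
case: u => x y n0 [/= x0 yx ua u1]; have d0 := @dyadic_gt0 R N.
have [a0 a1] := @dyadic_radius R N.
have n1 : 1 <= n%:R :> R by rewrite ler1n.
have x1 : x < 1.
  apply: le_lt_trans u1; rewrite (le_trans _ (modc_ge_Re x y))//.
  exact: ler_norm.
have ydx : 2 * n%:R * `|y| <= dl * x.
  by move: yx; rewrite mulrAC ler_pdivlMr ?mulr_gt0// 1?mulrC// (lt_le_trans _ n1).
have yx' : `|y| <= dl * x.
  apply: le_trans ydx; rewrite ler_peMl//; lra.
have uxy : modc (x +i* y) <= x + dl * x.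
  have -> : x +i* y = x%:C + y *i.
    by apply/eqP; rewrite eq_complex /= addr0 add0r !eqxx.
  rewrite (le_trans (modcD _ _))// modcR gtr0_norm// lerD2l.
  by rewrite /modc/= expr0n add0r sqrtr_sqr.
have wE : 1 - (1 - dl)%:C * toC (x, y) =
    (1 - (1 - dl) * x) +i* (- ((1 - dl) * y)).
  by apply/eqP; rewrite eq_complex /= !mul0r subr0 addr0 sub0r !eqxx.
(* The lower bound is x < 1. For the upper one, x >= (1 - e) / (1 + e) >= 1 - 2e, hence 1 - (1 - e)
   x <= 3e - 2e^2. *)
have bounds (e : R) : 0 <= 1 - e -> 0 < e -> 1 - e <= x + e * x ->
    e <= 1 - (1 - e) * x /\ 1 - (1 - e) * x <= 3 * e.
  move=> e1 e0 ex; split.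
    have : 0 <= (1 - e) * (1 - x) by rewrite mulr_ge0// subr_ge0 ltW.
    lra.
  have x2 : 1 - 2 * e <= x.
    rewrite -(@ler_pM2r _ (1 + e)); last by lra.
    have := sqr_ge0 e; rewrite expr2; lra.
  have : 0 <= (1 - e) * (x - (1 - 2 * e)) by rewrite mulr_ge0// subr_ge0.
  have := sqr_ge0 e; rewrite expr2; lra.
have [eU U3] := bounds _ a0 d0 (le_trans ua uxy).
rewrite /test_fun wE; move: eU U3; set U := 1 - (1 - dl) * x => eU U3.
have U0 : 0 < U by exact: lt_le_trans eU.
rewrite (@le_trans _ _ (2 * U ^+ n)^-1)//.
  rewrite lef_pV2 ?posrE; last 2 first.
  - by rewrite mulr_gt0// exprn_gt0// mulr_gt0.
  - by rewrite mulr_gt0// exprn_gt0.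
  rewrite ler_wpM2l//; apply: lerXn2r => //; rewrite nnegrE; first exact: ltW.
  by rewrite mulr_ge0// ltW.
apply: Re_inv_exprn_ge => //.
rewrite normrN normrM (ger0_norm a0) (le_trans _ eU)//.
rewrite (@le_trans _ _ (2 * n%:R * `|y|))//.
  by rewrite ler_wpM2l ?mulr_ge0// ler_piMl// ltW.
by rewrite (le_trans ydx)// ler_piMr// ltW.
Qed.

End test_functions.

(** * Lower bound for the radial averages *)

Section averaging_lower_bound.
Context {R : realType}.
Local Notation leb := (@lebesgue_measure R).
Local Notation plane := (measurableTypeR R * measurableTypeR R)%type.
Local Notation dA := (dA R).
Local Open Scope complex_scope.
Implicit Types (f : R[i] -> R[i]) (nu omega : R[i] -> R).

(** Moving outwards along a ray keeps the slope, so a bound on the sector holds on the whole segment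
    over which T averages. *)
Lemma sector_ray (a tau s : R) (u : plane) : sector a tau u ->
  modc (toC u) <= s -> s < 1 -> exists2 u' : plane, sector a tau u' &
  s%:C * (toC u / (modc (toC u))%:C) = toC u'.
Proof.
case: u => x y [x0 yx ua u1]; rewrite /= in x0 yx.
set r := modc (toC (x, y)) => rs s1.
have r0 : 0 < r.
  by rewrite (lt_le_trans x0)// (le_trans _ (modc_ge_Re x y))// ler_norm.
have s0 : 0 < s by exact: lt_le_trans rs.
have sr0 : 0 < s / r by rewrite divr_gt0.
have E : s%:C * (toC (x, y) / r%:C) = toC ((s / r) * x, (s / r) * y).
  rewrite /toC/= -(fmorphV (real_complex R)) mulrCA mulrC -rmorphM/=.
  by apply/eqP; rewrite eq_complex /= !mul0r subr0 addr0 mulrC !eqxx.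
have M : modc (toC ((s / r) * x, (s / r) * y)) = s.
  rewrite -E !modcM modcV !modcR -/r (gtr0_norm s0) (gtr0_norm r0).
  by rewrite divff ?gt_eqF// mulr1.
exists ((s / r) * x, (s / r) * y) => //; split; rewrite ?M//=.
- by rewrite mulr_gt0.
- by rewrite normrM (gtr0_norm sr0) mulrCA ler_wpM2l// ltW.
- exact: le_trans rs.
Qed.

(** The real part of T f is the mean of Re f along the ray for the weight omega of total mass
    [hat omega z], so b passes to it for every omega. *)
Lemma T_avg_ge omega f (b B : R) z : radial_weight omega -> disc z -> 0 <= b ->
  (forall s, modc z <= s -> s < 1 ->
    b <= complex.Re (f (s%:C * (z / (modc z)%:C))) <= B) ->
  b <= modc (T_avg omega f z).
Proof.
move=> ww zd b0 fb.
have om0 s : modc z <= s -> s < 1 -> 0 <= omega s%:C.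
  by move=> zs s1; apply: radial_weight_ge0 => //; rewrite (le_trans _ zs)// modc_ge0.
have B0 : 0 <= B.
  by have /andP[+ +] := fb _ (lexx _) zd; move=> /(le_trans b0); exact: le_trans.
have h0 := hat_gt0 ww zd; have hfin := hat_fin_num ww zd.
have h0' : 0 < fine (hat omega z) by rewrite fine_gt0// h0/= ltey_eq hfin.
pose X := (\int[leb]_(s in `[modc z, 1%R[)
  (complex.Re (radial_integrand omega f z s))%:E)%E.
have ReE s : complex.Re (radial_integrand omega f z s) =
    complex.Re (f (s%:C * (z / (modc z)%:C))) * omega s%:C.
  by rewrite /radial_integrand mulrC Re_mulR mulrC.
have Xlo : (b%:E * hat omega z <= X)%E.
  rewrite -integral_hatZ//; apply: ge0_le_integral_nonmeas => s /=.
    by rewrite in_itv/= => /andP[zs s1]; rewrite lee_fin mulr_ge0// om0.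
  rewrite in_itv/= => /andP[zs s1]; rewrite lee_fin ReE ler_wpM2r ?om0//.
  by have /andP[] := fb _ zs s1.
have Xhi : (X <= B%:E * hat omega z)%E.
  rewrite -integral_hatZ//; apply: ge0_le_integral_nonmeas => s /=.
    rewrite in_itv/= => /andP[zs s1]; rewrite lee_fin ReE mulr_ge0 ?om0//.
    by have /andP[+ _] := fb _ zs s1; exact: le_trans.
  rewrite in_itv/= => /andP[zs s1]; rewrite lee_fin ReE ler_wpM2r ?om0//.
  by have /andP[] := fb _ zs s1.
(* The real-valued integral is [fine] of X, which would be 0 at +oo; the bound B excludes this. *)
have Xfin : X \is a fin_num.
  rewrite ge0_fin_numE; last first.
    by apply: le_trans Xlo; rewrite mule_ge0// ltW.
  by apply: (le_lt_trans Xhi); rewrite -(fineK hfin) -EFinM ltry.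
rewrite /T_avg modcM modcV modcR (gtr0_norm h0') ler_pdivlMr//.
apply: le_trans (modc_ge_Re _ _); apply: le_trans (ler_norm _).
by rewrite /Rintegral -/X -lee_fin EFinM !fineK.
Qed.

Lemma T_avg_test_fun_ge omega (n N : nat) (u : plane) :
  radial_weight omega -> (0 < n)%N ->
  sector (1 - 2 ^- N) (2 ^- N / (2 * n%:R)) u ->
  (2 * (3 * 2 ^- N) ^+ n)^-1 <= modc (T_avg omega (test_fun n N) (toC u)).
Proof.
move=> ww n0 su; have d0 := @dyadic_gt0 R N.
apply: (T_avg_ge (B := (2 ^- N)^-1 ^+ n)) => //; first by case: su.
move=> s us s1; have [u' su' ->] := sector_ray su us s1.
rewrite Re_test_fun_ge//= (le_trans (Re_le_modc _))// modc_test_fun_le//.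
by case: su'.
Qed.

End averaging_lower_bound.

(** * Norm estimates and the incompatible powers *)

Section norms.
Context {R : realType}.
Local Notation plane := (measurableTypeR R * measurableTypeR R)%type.
Local Notation dA := (dA R).
Local Open Scope complex_scope.
Implicit Types (f : R[i] -> R[i]) (nu omega : R[i] -> R).

Lemma measurable_lebesgue_measurable (f : plane -> R) :
  measurable_fun setT f -> lebesgue_measurable_fun dA (@discP R) f.
Proof. by move=> mf; exists f; [exact: measurable_funTS|exact: aeW]. Qed.

Lemma weight_integralZ nu (phi : plane -> R) (c : R) : radial_weight nu ->
  measurable_fun setT phi -> (forall u, 0 <= phi u) -> 0 <= c ->
  (\int[dA]_(u in @discP R) (c * phi u * nu (toC u))%:E =
   c%:E * \int[dA]_(u in @discP R) (phi u * nu (toC u))%:E)%E.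
Proof.
move=> ww mphi phi0 c0; have [G [mG G0 intG _ _]] := weight_disc_borel ww.
rewrite !intG//; last 2 first.
- exact: measurable_funM.
- by move=> u; rewrite mulr_ge0.
under eq_integral do rewrite -mulrA EFinM.
rewrite ge0_integralZl_EFin//.
- exact: measurable_discP.
- by move=> u _; rewrite lee_fin mulr_ge0.
- by apply: measurable_funTS; apply/measurable_EFinP; exact: measurable_funM.
Qed.

Lemma test_fun_integral_bound nu (p : R) : Dhat nu -> 0 < p ->
  exists m0 : R, forall n : nat, m0 <= n%:R * p -> exists2 K : R, 0 < K &
  forall N, (0 < N)%N ->
  (\int[dA]_(u in @discP R) (modc (test_fun n N (toC u)) `^ p * nu (toC u))%:E <=
   (K * (2 ^- N) `^ (- (n%:R * p)) * (2 ^- N * dyadic_hat nu N))%:E)%E.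
Proof.
move=> Dnu p0; have [m0 Hm0] := dyadic_kernel_integral_bound Dnu.
exists m0 => n mn; have np0 : 0 <= n%:R * p by rewrite mulr_ge0// ltW.
have [K K0 HK] := Hm0 _ np0 mn.
have c0 : 0 < 2 `^ (n%:R * p) :> R by rewrite powR_gt0.
exists (2 `^ (n%:R * p) * K); first exact: mulr_gt0.
move=> N N0; rewrite -2!mulrA EFinM mulrA.
apply: (@le_trans _ _ ((2 `^ (n%:R * p))%:E * \int[dA]_(u in @discP R)
    (dyadic_kernel (n%:R * p) N u * nu (toC u))%:E)%E); last first.
  by apply: lee_wpmul2l; [rewrite lee_fin ltW|exact: HK].
rewrite -(weight_integralZ Dnu.1 (@measurable_dyadic_kernel R _ _) _ (ltW c0));
  last exact: dyadic_kernel_ge0.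
have [[nu0 _] _ _ _ _] := Dnu.1.
apply: ge0_le_integral_nonmeas => u du; rewrite lee_fin.
  by rewrite mulr_ge0 ?powR_ge0// nu0.
by rewrite ler_wpM2r ?nu0//; apply: modc_test_fun_powR => //; exact: ltW.
Qed.

Lemma test_fun_in_Aw nu (p : R) (n N : nat) :
  (\int[dA]_(u in @discP R) (modc (test_fun n N (toC u)) `^ p * nu (toC u))%:E
    < +oo)%E -> in_Aw p nu (test_fun n N).
Proof.
move=> fin; split; first exact: test_fun_analytic.
have [mRe mIm] := @cmeasurable_test_fun R n N.
by split=> //; exact: measurable_lebesgue_measurable.
Qed.

(** No measurability of h is assumed, as h will be |T f|: the measurable minorant b^q 1_S is
    integrated instead. *)
Lemma weighted_integral_sector_ge nu (h : plane -> R) (b tau q : R) (N : nat) :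
  radial_weight nu -> (0 < N)%N -> 0 <= b -> 0 <= tau -> tau <= 1 -> 0 <= q ->
  (forall u, sector (1 - 2 ^- N) tau u -> b <= h u) ->
  ((b `^ q * (tau / (2 * pi) * dyadic_hat nu N))%:E <=
   \int[dA]_(u in @discP R) (h u `^ q * nu (toC u))%:E)%E.
Proof.
move=> ww N0 b0 tau0 tau1 q0 bh; have [[nu0 _] _ _ _ _] := ww.
have [G [mG G0 intG _ secG]] := weight_disc_borel ww.
set S := sector (1 - 2 ^- N) tau in bh *.
have mS : measurable S by exact: measurable_sector.
have a2 : 2^-1 <= 1 - 2 ^- N :> R.
  by have := @dyadic_le_half R N N0; set e := 2 ^- N; move: e => e; lra.
have /andP[+ _] := secG _ _ a2 tau0 tau1; rewrite -/S dyadic_hatE// -EFinM => lo.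
apply: (@le_trans _ _ (\int[dA]_(u in @discP R)
    (b `^ q * \1_S u * nu (toC u))%:E)%E); last first.
  apply: ge0_le_integral_nonmeas => u du; rewrite lee_fin.
    by rewrite !mulr_ge0 ?powR_ge0 ?nu0.
  rewrite ler_wpM2r ?nu0// indicE; have [/set_mem uS|_] := boolP (u \in S).
    by rewrite mulr1 ge0_ler_powR ?nnegrE ?bh// (le_trans b0)// bh.
  by rewrite mulr0 powR_ge0.
rewrite weight_integralZ ?powR_ge0//.
rewrite EFinM; apply: lee_wpmul2l; first by rewrite lee_fin powR_ge0.
rewrite intG//; apply: (le_trans lo); rewrite le_eqVlt; apply/orP; left.
apply/eqP; rewrite integral_mkcond [RHS]integral_mkcond.
apply: eq_integral => u _; rewrite !patchE indicE.
have [uS|_] := boolP (u \in S); last by rewrite mul0r if_same.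
by rewrite mul1r mem_set//; have [] := set_mem uS.
Qed.

(** Dividing by w^(1/q) leaves 1 <= L w^e with e = 1/p - 1/q > 0, which fails as soon as w <
    L^(-1/e). *)
Lemma no_dyadic_power_bound (p q L H : R) (w : nat -> R) :
  0 < p -> p < q -> 0 < L -> (forall N, 0 < w N) ->
  (forall N, w N <= 2 ^- N * H) ->
  ~ (forall N, (0 < N)%N -> w N `^ q^-1 <= L * w N `^ p^-1).
Proof.
move=> p0 pq L0 w0 wH bound; have q0 := lt_trans p0 pq.
have H0 : 0 < H.
  by have := lt_le_trans (w0 0) (wH 0); rewrite expr0 invr1 mul1r.
pose e := p^-1 - q^-1.
have e0 : 0 < e by rewrite subr_gt0 ltf_pV2 ?posrE.
pose eta := L^-1 `^ e^-1.
have eta0 : 0 < eta by rewrite powR_gt0 ?invr_gt0.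
(* 2^N > N > H / eta, so that 2^-N H < eta. *)
pose N := (Num.truncn (H / eta)).+1.
have HN : 2 ^- N * H < eta.
  rewrite mulrC ltr_pdivrMr ?exprn_gt0// mulrC -ltr_pdivrMr//.
  rewrite (lt_le_trans (truncnS_gt _))// -natrX ler_nat ltnW//.
  exact: ltn_expl.
have wN : w N `^ e < L^-1.
  have -> : L^-1 = eta `^ e by rewrite -powRrM mulVf ?gt_eqF// powRr1// invr_ge0 ltW.
  by apply: gt0_ltr_powR => //; rewrite ?nnegrE ?ltW// (le_lt_trans (wH N)).
have := bound N erefl; rewrite (_ : p^-1 = q^-1 + e); last by rewrite addrC subrK.
rewrite powRD; last by rewrite (gt_eqF (w0 N)) implybT.
rewrite mulrCA ler_pMr ?powR_gt0// leNgt => /negP; apply.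
by rewrite mulrC -ltr_pdivlMr// mul1r.
Qed.

End norms.

Theorem corollary7 (R : realType) (p q : R) (nu : R[i] -> R)
    (hp : 0 < p) (hpq : p < q) (hnu : Dhat nu)
    (omega : R[i] -> R) (homega : radial_weight omega) :
  ~ T_bounded omega nu p q.
Proof.
move=> [C0 bounded]; have hq := lt_trans hp hpq.
have ww := hnu.1; have [[nu0 _] _ _ _ _] := ww.
have [m0 Hm0] := test_fun_integral_bound hnu hp.
(* This makes n p > m0. As n is fixed before N, the constant K is uniform in N. *)
pose n := (Num.truncn (m0 / p)).+1.
have n0 : (0 < n)%N by [].
have n1 : 1 <= n%:R :> R by rewrite ler1n.
have nR0 : 0 < n%:R :> R by rewrite ltr0n.
have [|K K0 HK] := Hm0 n; first by rewrite -ler_pdivrMr// ltW// truncnS_gt.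
pose w N := 2 ^- N * dyadic_hat nu N.
have w0 N : 0 < w N by rewrite mulr_gt0 ?dyadic_gt0 ?dyadic_hat_gt0.
(* The constant of boundedness carries no sign; the maximum makes L positive. *)
pose C1 := Num.max C0 1.
have C10 : 0 < C1 by rewrite lt_max ltr01 orbT.
(* c is tau / (2 pi) for tau = d / (2n), without d; likewise b below is the lower bound (2
   (3d)^n)^-1 without d^-n. *)
pose c := (4 * n%:R * pi)^-1 : R.
have c0 : 0 < c by rewrite invr_gt0 !mulr_gt0// pi_gt0.
pose b := (2 * 3 ^+ n)^-1 : R.
have b0 : 0 < b by rewrite invr_gt0 mulr_gt0// exprn_gt0.
pose L := C1 * K `^ p^-1 / (b * c `^ q^-1).
have L0 : 0 < L by rewrite divr_gt0 ?mulr_gt0 ?powR_gt0.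
apply: (@no_dyadic_power_bound R p q L (dyadic_hat nu 0) w) => // N.
  by rewrite ler_wpM2l ?(ltW (dyadic_gt0 _))// dyadic_hat_le0.
move=> N0; pose d : R := 2 ^- N.
have d0 : 0 < d by exact: dyadic_gt0.
have d2 : d <= 2^-1 by exact: dyadic_le_half.
have upper := HK N N0; rewrite -/d -/(w N) in upper.
have fA : in_Aw p nu (test_fun n N).
  by apply: test_fun_in_Aw; apply: (le_lt_trans upper); rewrite ltry.
have [_ _ TC] := bounded _ fA.
pose tau := d / (2 * n%:R).
have tau0 : 0 <= tau by rewrite divr_ge0 ?mulr_ge0 ?ltW.
have tau1 : tau <= 1.
  rewrite ler_pdivrMr ?mulr_gt0// mul1r (le_trans d2)//.
  by rewrite (@le_trans _ _ 1) ?invf_le1 ?ler1n//; lra.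
have dn0 : 0 < d ^+ n by rewrite exprn_gt0.
have lower : (((b / d ^+ n) `^ q * (c * w N))%:E <=
    \int[dA R]_(u in @discP R)
      (modc (T_avg omega (test_fun n N) (toC u)) `^ q * nu (toC u))%:E)%E.
  have -> : c * w N = tau / (2 * pi) * dyadic_hat nu N.
    rewrite /c /w -/d /tau mulrA; congr (_ * _).
    have : (pi : R) != 0 by rewrite gt_eqF ?pi_gt0.
    have : (n%:R : R) != 0 by rewrite gt_eqF.
    by move: (pi : R) (n%:R : R) => t m m0' t0; field; rewrite m0' t0.
  apply: weighted_integral_sector_ge => //.
  - by rewrite divr_ge0// ltW.
  - exact: ltW.
  - move=> u su; have := T_avg_test_fun_ge homega n0 su.
    by rewrite -/d exprMn mulrA invfM.
have lower' : ((b / d ^+ n * (c `^ q^-1 * w N `^ q^-1))%:E <=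
    Lnormw q nu (T_avg omega (test_fun n N)))%E.
  have -> : b / d ^+ n * (c `^ q^-1 * w N `^ q^-1) =
      ((b / d ^+ n) `^ q * (c * w N)) `^ q^-1.
    rewrite [RHS]powRM ?powR_ge0 ?(mulr_ge0 (ltW c0) (ltW (w0 _)))//.
    rewrite -powRrM mulfV ?gt_eqF// powRr1 ?(divr_ge0 (ltW b0) (ltW dn0))//.
    by rewrite powRM// ltW.
  rewrite -poweR_EFin; apply: gt0_ler_poweR => //.
  - by rewrite invr_ge0 ltW.
  - rewrite in_itv/= leey andbT lee_fin; apply: mulr_ge0; first exact: powR_ge0.
    by rewrite mulr_ge0// ltW.
  - by rewrite in_itv/= leey andbT integral_ge0// => u du; rewrite lee_fin
      mulr_ge0 ?powR_ge0// nu0.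
have upper' : (Lnormw p nu (test_fun n N) <=
    (K `^ p^-1 * (d ^- n * w N `^ p^-1))%:E)%E.
  have -> : K `^ p^-1 * (d ^- n * w N `^ p^-1) =
      (K * d `^ (- (n%:R * p)) * w N) `^ p^-1.
    have dm0 : 0 <= d `^ (- (n%:R * p)) by exact: powR_ge0.
    have -> : d ^- n = (d `^ (- (n%:R * p))) `^ p^-1.
      rewrite -powRrM mulNr mulfK ?gt_eqF// powRN powR_mulrn//; exact: ltW.
    have Kd0 := mulr_ge0 (ltW K0) dm0.
    by rewrite (powRM _ Kd0 (ltW (w0 N))) (powRM _ (ltW K0) dm0) mulrA.
  rewrite -poweR_EFin; apply: gt0_ler_poweR => //.
  - by rewrite invr_ge0 ltW.
  - by rewrite in_itv/= leey andbT integral_ge0// => u du; rewrite lee_fin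
      mulr_ge0 ?powR_ge0// nu0.
  - rewrite in_itv/= leey andbT lee_fin; apply: mulr_ge0; last exact: ltW.
    by rewrite mulr_ge0 ?powR_ge0// ltW.
have : ((b / d ^+ n * (c `^ q^-1 * w N `^ q^-1))%:E <=
    C1%:E * (K `^ p^-1 * (d ^- n * w N `^ p^-1))%:E)%E.
  apply: (le_trans lower'); apply: (le_trans TC).
  apply: (@le_trans _ _ (C1%:E * Lnormw p nu (test_fun n N))%E).
    by rewrite lee_wpmul2r ?poweR_ge0// lee_fin le_max lexx.
  by rewrite lee_wpmul2l// lee_fin ltW.
(* The common factor d^-n cancels here, leaving w^(1/q) against w^(1/p) with a constant independent
   of N. *)
rewrite -EFinM lee_fin => H; rewrite /L mulrAC ler_pdivlMr; last first.
  by rewrite mulr_gt0 ?powR_gt0.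
have Dn0 : 0 < d ^- n by rewrite invr_gt0.
rewrite -(ler_pM2r Dn0); move: H; move: (d ^- n) (c `^ q^-1) (K `^ p^-1).
move: (w N `^ q^-1) (w N `^ p^-1) => wq wp D cq Kp.
by congr (_ <= _); ring.
Qed.
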